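(* Let $\mathbb{X}$ be an override restriction category with override operator $\triangleright$. Then for all objects $A,B$ and all $f,g,h\in\mathbb{X}(A,B)$: (i) $\overline{f\triangleright g}=\overline{f}\triangleright\overline{g}$; (ii) $f\triangleright f=f$; (iii) if $f$ is total, then $f\triangleright g=f$; (iv) $f\le f\triangleright g$, that is, $\overline{f}(f\triangleright g)=f$; (v) $\overline{f\triangleright g}\,f=f$; (vi) $\overline{f\triangleright g}\,g=g$; (vii) $f\triangleright g=f$ if and only if $\overline{f}g=g$; (viii) $(f\triangleright g)\triangleright f=f\triangleright g$; (ix) $g\le f\triangleright g$ if and only if $f\smile g$; (x) if $f\le h$ and $g\le h$, then $f\triangleright g\le h$; (xi) $f\le g$ if and only if $f\triangleright g=g$; (xii) $f\triangleright g=g\triangleright f$ if and only if $f\smile g$; (xiii) $\overline{f}\triangleright\overline{g}=\overline{f\triangleright g}=\overline{g\triangleright f}=\overline{g}\triangleright\overline{f}$; (xiv) $\overline{f}\triangleright 1_A=1_A=1_A\triangleright\overline{f}$; (xv) $f$ is total if and only if $\overline{f}\triangleright 1_A=\overline{f}=1_A\triangleright\overline{f}$.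
   Context: Composition is written diagrammatically: for $f:A\to B$ and $g:B\to C$, $fg:A\to C$ is $f$ followed by $g$. Composition binds more tightly than all other binary operations. A restriction category is a category $\mathbb{X}$ equipped with operations $\overline{(-)}:\mathbb{X}(A,B)\to\mathbb{X}(A,A)$ for all objects $A,B$ such that: [R.1] $\overline{f}f=f$ for $f\in\mathbb{X}(A,B)$; [R.2] $\overline{f}\,\overline{g}=\overline{g}\,\overline{f}$ for $f\in\mathbb{X}(A,B)$, $g\in\mathbb{X}(A,C)$; [R.3] $\overline{\overline{f}g}=\overline{f}\,\overline{g}$ for $f\in\mathbb{X}(A,B)$, $g\in\mathbb{X}(A,C)$; [R.4] $f\overline{g}=\overline{fg}f$ for $f\in\mathbb{X}(A,B)$, $g\in\mathbb{X}(B,C)$. For $f,g\in\mathbb{X}(A,B)$: $f$ is total if $\overline{f}=1_A$; $f\le g$ means $\overline{f}g=f$ (this is a partial order on each homset); $f\smile g$ ($f$ and $g$ are compatible) means $\overline{g}f=\overline{f}g$. An override restriction category is a restriction category $\mathbb{X}$ with binary operations $\triangleright:\mathbb{X}(A,B)\times\mathbb{X}(A,B)\to\mathbb{X}(A,B)$ for all objects $A,B$ (an override operator) such that: (1) $(f\triangleright g)\triangleright h=f\triangleright(g\triangleright h)$ for $f,g,h\in\mathbb{X}(A,B)$; (2) $f\triangleright\overline{f}g=f$ for $f,g\in\mathbb{X}(A,B)$; (3) $\overline{g}f\triangleright f=f$ for $f\in\mathbb{X}(A,B)$, $g\in\mathbb{X}(A,C)$; (4) $f(g\triangleright h)=fg\triangleright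 fh$ for $f\in\mathbb{X}(A,B)$, $g,h\in\mathbb{X}(B,C)$; (5) $\overline{f\triangleright g}\,h=\overline{f}h\triangleright\overline{g}h$ for $f,g\in\mathbb{X}(A,C)$, $h\in\mathbb{X}(A,B)$. *)

(* Defs.v *)
Set Implicit Arguments.
Unset Strict Implicit.

Declare Scope rcat_scope.
Delimit Scope rcat_scope with rcat.
Open Scope rcat_scope.

Reserved Notation "f ;; g" (at level 40, left associativity).
Reserved Notation "f |> g" (at level 50, left associativity).
Reserved Notation "f <=r g" (at level 70, no associativity).

(* Composition is diagrammatic: [f ;; g] is [f] followed by [g]. *)
Record category : Type := Category {
  obj :> Type;
  hom : obj -> obj -> Type;
  idm : forall A : obj, hom A A;
  comp : forall {A B C : obj}, hom A B -> hom B C -> hom A C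
    where "f ;; g" := (comp f g) : rcat_scope;
  comp_idl : forall (A B : obj) (f : hom A B), idm A ;; f = f;
  comp_idr : forall (A B : obj) (f : hom A B), f ;; idm B = f;
  compA : forall (A B C D : obj) (f : hom A B) (g : hom B C) (h : hom C D),
    f ;; (g ;; h) = (f ;; g) ;; h
}.

Arguments hom {c} _ _.
Arguments idm {c} _.
Arguments comp {c A B C} _ _.

Notation "f ;; g" := (comp f g) : rcat_scope.

Record restriction_category : Type := RestrictionCategory {
  rcat_category :> category;
  rst : forall {A B : rcat_category}, hom A B -> hom A A;
  rst_R1 : forall (A B : rcat_category) (f : hom A B), rst f ;; f = f;
  rst_R2 : forall (A B C : rcat_category) (f : hom A B) (g : hom A C),
    rst f ;; rst g = rst g ;; rst f;
  rst_R3 : forall (A B C : rcat_category) (f : hom A B) (g : hom A C),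
    rst (rst f ;; g) = rst f ;; rst g;
  rst_R4 : forall (A B C : rcat_category) (f : hom A B) (g : hom B C),
    f ;; rst g = rst (f ;; g) ;; f
}.

Arguments rst {r A B} _.

Definition total (X : restriction_category) (A B : X) (f : hom A B) : Prop :=
  rst f = idm A.

Definition rle (X : restriction_category) (A B : X) (f g : hom A B) : Prop :=
  rst f ;; g = f.

Notation "f <=r g" := (rle f g) : rcat_scope.

Definition compatible (X : restriction_category) (A B : X) (f g : hom A B)
  : Prop :=
  rst g ;; f = rst f ;; g.

Record override_category : Type := OverrideCategory {
  ocat_restriction :> restriction_category;
  ovr : forall {A B : ocat_restriction}, hom A B -> hom A B -> hom A B
    where "f |> g" := (ovr f g) : rcat_scope;
  ovrA : forall (A B : ocat_restriction) (f g h : hom A B),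
    (f |> g) |> h = f |> (g |> h);
  ovr_rstl : forall (A B : ocat_restriction) (f g : hom A B),
    f |> rst f ;; g = f;
  ovr_absorb : forall (A B C : ocat_restriction) (f : hom A B) (g : hom A C),
    rst g ;; f |> f = f;
  comp_ovr : forall (A B C : ocat_restriction) (f : hom A B) (g h : hom B C),
    f ;; (g |> h) = f ;; g |> f ;; h;
  rst_ovr_comp :
    forall (A B C : ocat_restriction) (f g : hom A C) (h : hom A B),
      rst (f |> g) ;; h = rst f ;; h |> rst g ;; h
}.

Arguments ovr {o A B} _ _.

Notation "f |> g" := (ovr f g) : rcat_scope.

(* Main.v *)
From Stdlib Require Import Setoid.
Require Import Defs.

(** Read [f |> g] as [f] where [f] is defined and [g] elsewhere. Composing with restrictions
    distributes over [|>], which reduces most claims to [ovr_absorb] or to [ovr_eql]: [f] swallows a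
    [g] that [rst f] fixes. For commutativity the order does the work: [f |> g] always lies above
    [f], lies above [g] exactly under compatibility ([rle_ovrrP]), and lies below each common upper
    bound ([ovr_rle]); antisymmetry then swaps the operands. *)

Section Restriction.
Set Implicit Arguments.
Unset Strict Implicit.

Variable X : restriction_category.

Lemma rst_idm (A : X) : rst (idm A) = idm A.
Proof. rewrite <- (comp_idr (rst (idm A))). apply rst_R1. Qed.

Lemma rst_rst (A B : X) (f : hom A B) : rst (rst f) = rst f.
Proof.
rewrite <- (comp_idr (rst f)) at 1.
now rewrite rst_R3, rst_idm, comp_idr.
Qed.

Lemma rst_compCA (A B C D : X) (f : hom A B) (g : hom A C) (h : hom A D) :
  rst f ;; (rst g ;; h) = rst g ;; (rst f ;; h).
Proof. now rewrite !compA, (rst_R2 f g). Qed.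

Lemma rst_idem (A B C : X) (f : hom A B) (g : hom A C) :
  rst f ;; (rst f ;; g) = rst f ;; g.
Proof. now rewrite compA, <- rst_R3, rst_R1. Qed.

Lemma rle_antisym (A B : X) (f g : hom A B) : f <=r g -> g <=r f -> f = g.
Proof.
unfold rle; intros fg gf.
now rewrite <- fg, <- gf at 1; rewrite rst_compCA, rst_R1.
Qed.

Lemma compatible_sym (A B : X) (f g : hom A B) :
  compatible f g -> compatible g f.
Proof. intro fg; exact (eq_sym fg). Qed.

Lemma rst_compatible (A B C : X) (f : hom A B) (g : hom A C) :
  compatible (rst f) (rst g).
Proof. unfold compatible. rewrite !rst_rst. apply rst_R2. Qed.

End Restriction.

Section Override.
Variable X : override_category.

(** This is [rst_ovr_comp] with the identity in place of [h]. *)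
Lemma rst_ovr (A B : X) (f g : hom A B) : rst (f |> g) = rst f |> rst g.
Proof.
rewrite <- (comp_idr (rst (f |> g))), rst_ovr_comp.
now rewrite !comp_idr.
Qed.

Lemma ovr_idem (A B : X) (f : hom A B) : f |> f = f.
Proof. rewrite <- (rst_R1 f) at 2. apply ovr_rstl. Qed.

Lemma ovr_eql (A B : X) (f g : hom A B) : rst f ;; g = g -> f |> g = f.
Proof. intro fg; rewrite <- fg; apply ovr_rstl. Qed.

Lemma total_ovr (A B : X) (f g : hom A B) : total f -> f |> g = f.
Proof. intro ft; apply ovr_eql; rewrite ft; apply comp_idl. Qed.

Lemma rle_ovrl (A B : X) (f g : hom A B) : f <=r (f |> g).
Proof. unfold rle. rewrite comp_ovr, rst_R1. apply ovr_rstl. Qed.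

Lemma rst_ovr_compl (A B : X) (f g : hom A B) : rst (f |> g) ;; f = f.
Proof.
rewrite rst_ovr_comp, rst_R1; apply ovr_eql.
now rewrite rst_compCA, rst_R1.
Qed.

Lemma rst_ovr_compr (A B : X) (f g : hom A B) : rst (f |> g) ;; g = g.
Proof. rewrite rst_ovr_comp, rst_R1. apply ovr_absorb. Qed.

Lemma ovr_eqlP (A B : X) (f g : hom A B) : f |> g = f <-> rst f ;; g = g.
Proof.
split; [intro fg | apply ovr_eql].
(* Only the [f] under [rst] is expanded, since [rst (f |> g)] fixes [g]. *)
rewrite <- fg at 1; apply rst_ovr_compr.
Qed.

Lemma ovrK (A B : X) (f g : hom A B) : (f |> g) |> f = f |> g.
Proof. apply ovr_eql, rst_ovr_compl. Qed.

Lemma rle_ovrrP (A B : X) (f g : hom A B) :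
  g <=r (f |> g) <-> compatible f g.
Proof.
unfold rle, compatible; rewrite comp_ovr, rst_R1; split; intro fg.
- (* Cut down to the common domain, where overriding returns its left operand. *)
  rewrite <- fg at 2.
  rewrite comp_ovr, (rst_compCA f g f), rst_R1; symmetry.
  apply ovr_eql.
  now rewrite rst_R3, <- compA, rst_idem, rst_compCA, rst_R1.
- rewrite fg; apply ovr_absorb.
Qed.

Lemma ovr_rle (A B : X) (f g h : hom A B) :
  f <=r h -> g <=r h -> (f |> g) <=r h.
Proof. unfold rle; intros fh gh. now rewrite rst_ovr_comp, fh, gh. Qed.

Lemma rle_ovr_eqrP (A B : X) (f g : hom A B) : f <=r g <-> f |> g = g.
Proof.
split; intro fg.
- rewrite <- fg; apply ovr_absorb.
- rewrite <- fg; apply rle_ovrl.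
Qed.

(** Under compatibility [f |> g] is a common upper bound of [g] and [f]. *)
Lemma ovr_rle_comm (A B : X) (f g : hom A B) :
  compatible f g -> (g |> f) <=r (f |> g).
Proof.
intro fg; apply ovr_rle; [now apply rle_ovrrP | apply rle_ovrl].
Qed.

Lemma ovr_commP (A B : X) (f g : hom A B) :
  f |> g = g |> f <-> compatible f g.
Proof.
split; intro fg.
- apply rle_ovrrP; rewrite fg; apply rle_ovrl.
- now apply rle_antisym; apply ovr_rle_comm; [apply compatible_sym |].
Qed.

(** Restriction idempotents commute, so they are compatible even when [f] and [g] are not. *)
Lemma rst_ovrC (A B : X) (f g : hom A B) : rst (f |> g) = rst (g |> f).
Proof. rewrite !rst_ovr. apply ovr_commP, rst_compatible. Qed.

(** Absorption applied to the identity, with [rst f] seen as [rst f ;; idm A]. *)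
Lemma rst_ovr_idm (A B : X) (f : hom A B) : rst f |> idm A = idm A.
Proof. rewrite <- (comp_idr (rst f)). apply ovr_absorb. Qed.

Lemma idm_ovr (A : X) (f : hom A A) : idm A |> f = idm A.
Proof. apply total_ovr, rst_idm. Qed.

End Override.

Theorem lemma14 (X : override_category) (A B : X) (f g h : hom A B) :
  (* (i) *)    rst (f |> g) = rst f |> rst g /\
  (* (ii) *)   f |> f = f /\
  (* (iii) *)  (total f -> f |> g = f) /\
  (* (iv) *)   (f <=r (f |> g) /\ rst f ;; (f |> g) = f) /\
  (* (v) *)    rst (f |> g) ;; f = f /\
  (* (vi) *)   rst (f |> g) ;; g = g /\
  (* (vii) *)  (f |> g = f <-> rst f ;; g = g) /\
  (* (viii) *) (f |> g) |> f = f |> g /\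
  (* (ix) *)   (g <=r (f |> g) <-> compatible f g) /\
  (* (x) *)    (f <=r h -> g <=r h -> (f |> g) <=r h) /\
  (* (xi) *)   (f <=r g <-> f |> g = g) /\
  (* (xii) *)  (f |> g = g |> f <-> compatible f g) /\
  (* (xiii) *) (rst f |> rst g = rst (f |> g) /\
                rst (f |> g) = rst (g |> f) /\
                rst (g |> f) = rst g |> rst f) /\
  (* (xiv) *)  (rst f |> idm A = idm A /\ idm A = idm A |> rst f) /\
  (* (xv) *)   (total f <->
                  rst f |> idm A = rst f /\ rst f = idm A |> rst f).
Proof.
repeat match goal with |- _ /\ _ => split end.
- apply rst_ovr.
- apply ovr_idem.
- apply total_ovr.
- apply rle_ovrl.
- apply rle_ovrl.
- apply rst_ovr_compl.
- apply rst_ovr_compr.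
- apply ovr_eqlP.
- apply ovrK.
- apply rle_ovrrP.
- apply ovr_rle.
- apply rle_ovr_eqrP.
- apply ovr_commP.
- symmetry; apply rst_ovr.
- apply rst_ovrC.
- apply rst_ovr.
- apply rst_ovr_idm.
- symmetry; apply idm_ovr.
(* Both overrides collapse to [idm A], so each equation just says that [f] is total. *)
- rewrite rst_ovr_idm, idm_ovr; unfold total; split; [intro ft | intros [_ ft]].
  + now rewrite ft.
  + exact ft.
Qed.
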